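(* (Triangle.) For integers $i\ge 2$, $j\ge 1$ let $$u^\triangle_{ij}(x,y)=\hat L_i\Big(\tfrac{2x}{1-y}\Big)\Big(\tfrac{1-y}{2}\Big)^i\hat P_j^{2i}(y),$$ and for integers $k\ge 2$, $l\ge 1$ let $$\hat b^\triangle_{kl}(x,y)=P^{(1,1)}_{k-2}\Big(\tfrac{2x}{1-y}\Big)\Big(\tfrac{1-y}{2}\Big)^{k-2}P^{(2k-1,1)}_{l-1}(y).$$ Then these functions form a biorthogonal system on $\triangle$, i.e. $$\int_\triangle u^\triangle_{ij}(x,y)\,\hat b^\triangle_{kl}(x,y)\,dx\,dy=c\,\delta_{ik}\delta_{jl}$$ with a nonzero constant $c$ depending only on the indices. (Tetrahedron.) For integers $i\ge 2$, $j,k\ge 1$ let $$u^\blacktriangle_{ijk}(x,y,z)=\hat L_i\Big(\tfrac{4x}{1-2y-z}\Big)\Big(\tfrac{1-2y-z}{4}\Big)^i\hat P_j^{2i}\Big(\tfrac{2y}{1-z}\Big)\Big(\tfrac{1-z}{2}\Big)^j\hat P_k^{2i+2j}(z),$$ and for integers $l\ge 2$, $n,m\ge 1$ let $$b^\blacktriangle_{lnm}(x,y,z)=P^{(1,1)}_{l-2}\Big(\tfrac{4x}{1-2y-z}\Big)\Big(\tfrac{1-2y-z}{4}\Big)^{l-2}P^{(2l-1,1)}_{n-1}\Big(\tfrac{2y}{1-z}\Big)\Big(\tfrac{1-z}{2}\Big)^{n-1}P^{(2l+2n-1,1)}_{m-1}(z).$$ Then these functions are biorthogonal, i.e. $$\int_\blacktriangle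 u^\blacktriangle_{ijk}\,b^\blacktriangle_{lnm}\,dx\,dy\,dz=\tilde c\,\delta_{il}\delta_{jn}\delta_{km}$$ with a nonzero constant $\tilde c$ depending only on the indices.
   Context: $P_n^{(\alpha,\beta)}$ ($n\ge 0$, $\alpha,\beta>-1$) is the classical Jacobi polynomial of degree $n$, orthogonal on $(-1,1)$ with respect to the weight $(1-x)^\alpha(1+x)^\beta$, $P_n^{(\alpha,\beta)}(x)=\frac{1}{2^n n!(1-x)^\alpha(1+x)^\beta}\frac{d^n}{dx^n}\big[(1-x)^\alpha(1+x)^\beta(x^2-1)^n\big]$. The integrated Jacobi polynomials are $\hat P_n^\alpha(x)=\int_{-1}^x P_{n-1}^{(\alpha,0)}(t)\,dt$ for $n\ge1$, and the integrated Legendre polynomials are $\hat L_n=\hat P_n^0$. $\triangle\subset\mathbb R^2$ is the triangle with vertices $(-1,-1),(1,-1),(0,1)$, and $\blacktriangle\subset\mathbb R^3$ is the tetrahedron with vertices $(-1,-1,-1),(1,-1,-1),(0,1,-1),(0,0,1)$. $\delta$ is the Kronecker symbol. *)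

(* Defs.v *)
(* Jacobi polynomials and polynomial systems on the triangle and tetrahedron,
   in MathComp-Analysis, over an arbitrary [R : realType]. *)
From HB Require Import structures.
From mathcomp Require Import all_boot all_order all_algebra.
From mathcomp Require Import all_classical all_reals all_analysis.
From mathcomp Require Import ring lra.
Set Implicit Arguments.
Unset Strict Implicit.
Unset Printing Implicit Defensive.
Import Order.TTheory GRing.Theory Num.Theory.
Import numFieldNormedType.Exports.
Local Open Scope classical_set_scope.
Local Open Scope ring_scope.

Definition jacobi_weight (R : realType) (a b x : R) : R :=
  (1 - x) `^ a * (1 + x) `^ b.

Definition jacobi_rodrigues (R : realType) (a b : R) (n : nat) (x : R) : R :=
  (2 ^+ n * n`!%:R * jacobi_weight a b x)^-1 *
  (fun t => jacobi_weight a b t * (t ^+ 2 - 1) ^+ n)^`(n)%classic x.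

(* Rodrigues' formula makes sense on ]-1, 1[ only; the Jacobi polynomial is the
   unique polynomial agreeing with it there (lemmas [jacobiE] and
   [jacobi_unique] below). *)
Definition jacobi (R : realType) (a b : R) (n : nat) : {poly R} :=
  xget 0 [set p : {poly R} |
    forall x : R, -1 < x < 1 -> p.[x] = jacobi_rodrigues a b n x].

Section jacobi_spec.
Variables (R : realType) (a b : R).

Let jacobi_weight_gt0 (x : R) : -1 < x < 1 -> 0 < jacobi_weight a b x.
Proof. by move=> /andP[x1 x2]; rewrite mulr_gt0// powR_gt0//; lra. Qed.

Let is_derive_jacobi_weight (x : R) : -1 < x < 1 ->
  is_derive x 1 (jacobi_weight a b)
    (jacobi_weight a b x * (b / (1 + x) - a / (1 - x))).
Proof.
move=> /andP[x1 x2].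
have h1 : 0 < 1 - x by lra.
have h2 : 0 < 1 + x by lra.
have d1 : is_derive x 1 (fun t => (1 - t) `^ a) (- (a * (1 - x) `^ (a - 1))).
  have e : is_derive x 1 (fun t : R => 1 - t) (-1).
    by have := is_deriveB (is_derive_cst (1 : R) x 1) (is_derive_id x 1); rewrite sub0r.
  have := @is_derive1_comp _ (fun t => t `^ a) (fun t => 1 - t) _ _ _ (is_derive1_powR a h1) e.
  by rewrite mulrN1.
have d2 : is_derive x 1 (fun t => (1 + t) `^ b) (b * (1 + x) `^ (b - 1)).
  have e : is_derive x 1 (fun t : R => 1 + t) 1.
    by have := is_deriveD (is_derive_cst (1 : R) x 1) (is_derive_id x 1); rewrite add0r.
  have := @is_derive1_comp _ (fun t => t `^ b) (fun t => 1 + t) _ _ _ (is_derive1_powR b h2) e.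
  by rewrite mulr1.
apply: (is_derive_eq (is_deriveM d1 d2)).
rewrite !powRB ?(gt_eqF h1) ?(gt_eqF h2) ?implybT// !powRr1 ?ltW//.
rewrite /GRing.scale/= /jacobi_weight.
by field; rewrite (gt_eqF h1) (gt_eqF h2).
Qed.

Let rodrigues_iter (n m : nat) : (m <= n)%N -> exists q : {poly R},
  forall x, -1 < x < 1 ->
  (fun t => jacobi_weight a b t * (t ^+ 2 - 1) ^+ n)^`(m)%classic x =
  jacobi_weight a b x * (x ^+ 2 - 1) ^+ (n - m) * q.[x].
Proof.
elim: m => [_|m IH mn].
  by exists 1 => x _; rewrite derive1n0 subn0 hornerC mulr1.
have [q qE] := IH (ltnW mn).
pose k := (n - m.+1)%N.
have nmE : (n - m = k.+1)%N by rewrite /k subnSK.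
pose r := ('X^2 - 1) ^+ k.+1 * q.
exists ((a%:P * (1 + 'X) - b%:P * (1 - 'X)) * q
  + (k.+1%:R%:P * (2%:P * 'X)) * q + ('X^2 - 1) * q^`()) => x x11.
rewrite derive1nS derive1E.
rewrite (@near_eq_derive _ _ _ _ (fun t => jacobi_weight a b t * r.[t])); last first.
  near=> t.
  have t11 : -1 < t < 1 by near: t; exact: near_in_itvoo.
  by rewrite qE// nmE /r !(hornerE, horner_exp).
rewrite (@derive_val _ _ _ _ _ _ _ (is_deriveM (is_derive_jacobi_weight x11) (is_derive_poly r x))).
move: (jacobi_weight a b x) => w.
have -> : r^`() = (k.+1%:R%:P * (2%:P * 'X)) * ('X^2 - 1) ^+ k * q
    + ('X^2 - 1) ^+ k.+1 * q^`().
  rewrite /r derivM deriv_exp derivB derivXn derivC subr0 expr1 /=.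
  by rewrite -mulr_natl -(mulr_natl _ 2) polyC_natr polyC_natr !mulrA.
rewrite /r -/k /GRing.scale/= !(hornerE, horner_exp) (exprS _ k) /=.
have /andP[x1 x2] := x11.
have h1 : 1 - x != 0 by rewrite gt_eqF//; lra.
have h2 : 1 + x != 0 by rewrite gt_eqF//; lra.
by field; rewrite h1 h2.
Unshelve. all: by end_near. Qed.

Lemma jacobiE (n : nat) (x : R) :
  -1 < x < 1 -> (jacobi a b n).[x] = jacobi_rodrigues a b n x.
Proof.
rewrite /jacobi; case: xgetP => [p _ /(_ x)//|/= nex].
have [q qE] := rodrigues_iter (leqnn n).
case: (nex ((2 ^+ n * n`!%:R)^-1 *: q)) => y y11.
have wy : jacobi_weight a b y != 0 by rewrite gt_eqF// jacobi_weight_gt0.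
rewrite /jacobi_rodrigues qE// subnn expr0 mulr1 hornerZ [in RHS]invfM.
by rewrite -[RHS]mulrA mulKf.
Qed.

Lemma jacobi_unique (n : nat) (p : {poly R}) :
  (forall x : R, -1 < x < 1 -> p.[x] = jacobi_rodrigues a b n x) ->
  p = jacobi a b n.
Proof.
move=> pE; apply/eqP; rewrite -subr_eq0; apply: contraT => pq0.
pose s := [seq (i.+2)%:R^-1 : R | i <- iota 0 (size (p - jacobi a b n)%R)].
have : (size s < size (p - jacobi a b n)%R)%N.
  apply: max_poly_roots => //.
    apply/allP => x /mapP[i _ ->].
    have lt1 : (i.+2%:R : R)^-1 < 1 by rewrite invf_lt1// ltr1n.
    have gt0 : 0 < (i.+2%:R : R)^-1 by rewrite invr_gt0.
    have i11 : -1 < (i.+2%:R : R)^-1 < 1 by rewrite lt1 andbT (lt_trans _ gt0)// ltrN10.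
    by rewrite rootE hornerD hornerN pE// jacobiE// subrr.
  rewrite map_inj_uniq ?iota_uniq// => i j /invr_inj/eqP.
  by rewrite eqr_nat => /eqP[].
by rewrite size_map size_iota ltnn.
Qed.

End jacobi_spec.

(* Meant for x in [-1, 1]. *)
Definition int_jacobi (R : realType) (a : R) (n : nat) (x : R) : R :=
  \int[@lebesgue_measure R]_(t in `[-1, x]) (jacobi a 0 n.-1).[t].

Definition int_legendre (R : realType) (n : nat) (x : R) : R :=
  int_jacobi 0 n x.

Definition convex_hull (R : realType) (V : lmodType R) (n : nat)
    (v : n.-tuple V) : set V :=
  [set p | exists w : 'I_n -> R,
    [/\ forall i, 0 <= w i, \sum_i w i = 1 & p = \sum_i w i *: tnth v i]].

Definition triangle (R : realType) : set (R * R)%type :=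
  convex_hull [tuple (-1, -1); (1, -1); (0, 1)].
Arguments triangle R : clear implicits.

Definition tetrahedron (R : realType) : set (R * R * R)%type :=
  convex_hull [tuple (-1, -1, -1); (1, -1, -1); (0, 1, -1); (0, 0, 1)].
Arguments tetrahedron R : clear implicits.

(* The functions below involve divisions by quantities vanishing at a vertex
   or on an edge of the domain; there [x / 0 = 0], on a set of measure zero. *)
Definition u_tri (R : realType) (i j : nat) (p : R * R) : R :=
  let: (x, y) := p in
  int_legendre i (2 * x / (1 - y)) * ((1 - y) / 2) ^+ i *
  int_jacobi (2 * i%:R) j y.

Definition b_tri (R : realType) (k l : nat) (p : R * R) : R :=
  let: (x, y) := p in
  (jacobi 1 1 (k - 2)).[2 * x / (1 - y)] * ((1 - y) / 2) ^+ (k - 2) *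
  (jacobi (2 * k%:R - 1) 1 (l - 1)).[y].

Definition u_tet (R : realType) (i j k : nat) (p : R * R * R) : R :=
  let: (x, y, z) := p in
  int_legendre i (4 * x / (1 - 2 * y - z)) * ((1 - 2 * y - z) / 4) ^+ i *
  int_jacobi (2 * i%:R) j (2 * y / (1 - z)) * ((1 - z) / 2) ^+ j *
  int_jacobi (2 * i%:R + 2 * j%:R) k z.

Definition b_tet (R : realType) (l n m : nat) (p : R * R * R) : R :=
  let: (x, y, z) := p in
  (jacobi 1 1 (l - 2)).[4 * x / (1 - 2 * y - z)] *
  ((1 - 2 * y - z) / 4) ^+ (l - 2) *
  (jacobi (2 * l%:R - 1) 1 (n - 1)).[2 * y / (1 - z)] *
  ((1 - z) / 2) ^+ (n - 1) *
  (jacobi (2 * l%:R + 2 * n%:R - 1) 1 (m - 1)).[z].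

(* Main.v *)
Require Import Defs.
From HB Require Import structures.
From mathcomp Require Import all_boot all_order all_algebra.
From mathcomp Require Import all_classical all_reals all_analysis.
From mathcomp Require Import measurable_realfun ring lra zify.
Import Order.TTheory GRing.Theory Num.Theory.
Import numFieldNormedType.Exports.
Local Open Scope classical_set_scope.
Local Open Scope ring_scope.
Set Implicit Arguments.
Unset Strict Implicit.
Unset Printing Implicit Defensive.

(** In the coordinates s = x / w, t = y / h, with h the height variable
    ((1 - z) / 2 on the tetrahedron, 1 on the triangle) and w = (h - y) / 2, both
    integrals factor into one-dimensional ones.  On the triangle they are

      int L_i(s) P_(k-2)^(1,1)(s) ds                                        and
      int ((1 - y) / 2)^(i+k-1) Phat_j^(2i)(y) P_(l-1)^(2k-1,1)(y) dy.

    The first one is a multiple of the Kronecker symbol of i and k, because the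
    integrated Legendre polynomial L_i is a nonzero multiple of
    (1 - s^2) P_(i-2)^(1,1)(s) ([primitive_legendre]).  When i = k the second one
    carries the weight (1 - y)^(2i-1), and it is a multiple of the Kronecker symbol
    of j and l, because Phat_j^(a+1) is a nonzero multiple of
    (1 + y) P_(j-1)^(a,1)(y) ([primitive_jacobi], used with a = 2i - 1).  The
    tetrahedron adds a third integral of the second kind, in which the powers of
    (1 - z) / 2 add up to 2i + 2j - 1 when i = l and j = n.

    The one-dimensional facts concern polynomials only: the integral over [-1, 1] is
    the linear form [polyint], and orthogonality follows from Rodrigues' formula, read
    as an identity of polynomials, by repeated integration by parts ([jacobi_orth]).
    The first contiguity relation compares two Rodrigues formulas; the second holds
    because ((1 + X) P_n^(a,1))' is orthogonal, for the weight (1 - X)^(a+1), to all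
    polynomials of degree less than n.

    The change of variables needs no Jacobian: A(x / w) w^d is a polynomial in x and w
    as soon as deg A <= d ([homog]), so the integrand agrees on the domain, also where
    w or h vanishes, with a polynomial function ([tri_funE]).  Such a function is
    bounded and measurable, Fubini's theorem applies ([integral_slices]), and every
    slice is integrated with an explicit antiderivative ([integral_homog]). *)

(** * Integration of polynomials over [-1, 1] *)

Section Polynomials.
Variable R : realType.
Implicit Types (p q r : {poly R}) (x y : R).

Lemma poly_eq0_oo p : (forall x, -1 < x < 1 -> p.[x] = 0) -> p = 0.
Proof.
move=> p0; apply/eqP/contraT => pn0.
pose s := [seq (i.+2)%:R^-1 : R | i <- iota 0 (size p)].
have : (size s < size p)%N.
  apply: max_poly_roots => //.
    apply/allP => x /mapP[i _ ->]; rewrite rootE p0//.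
    have lt1 : (i.+2%:R : R)^-1 < 1 by rewrite invf_lt1// ltr1n.
    have gt0 : 0 < (i.+2%:R : R)^-1 by rewrite invr_gt0.
    by rewrite lt1 (lt_trans _ gt0)// ltrN10.
  by rewrite map_inj_uniq ?iota_uniq// => i j /invr_inj/eqP; rewrite eqr_nat => /eqP[].
by rewrite size_map size_iota ltnn.
Qed.

(** The antiderivative of [p] with zero constant coefficient; at [i = 0] the division
    by zero yields that coefficient. *)
Definition antideriv p : {poly R} := \poly_(i < (size p).+1) (p`_i.-1 / i%:R).

Lemma coef_antideriv p i : (antideriv p)`_i = p`_i.-1 / i%:R.
Proof.
rewrite coef_poly ltnS; case: leqP => // h.
by rewrite nth_default ?mul0r//; case: i h.
Qed.

Lemma antiderivK p : (antideriv p)^`() = p.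
Proof.
apply/polyP => i; rewrite coef_deriv coef_antideriv/= -[LHS]mulr_natr divfK//.
Qed.

Lemma antideriv_is_linear : linear antideriv.
Proof.
by move=> c p q; apply/polyP => i; rewrite !(coefD, coefZ, coef_antideriv); ring.
Qed.

Lemma deriv_eq0 p : p^`() = 0 -> p = (p`_0)%:P.
Proof.
move=> p0; apply/polyP => -[|i]; rewrite coefC//=.
have := congr1 (fun q : {poly R} => q`_i) p0.
rewrite coef_deriv coef0 => /eqP; rewrite mulrn_eq0/= => /eqP//.
Qed.

(** The integral of [p] over [-1, 1], as a linear form on polynomials. *)
Definition polyint p : R := (antideriv p).[1] - (antideriv p).[-1].

Lemma polyint_is_linear : linear_for *%R polyint.
Proof.
by move=> c p q; rewrite /polyint antideriv_is_linear !hornerD !hornerZ; ring.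
Qed.

HB.instance Definition _ :=
  GRing.isLinear.Build R {poly R} R _ polyint polyint_is_linear.

Lemma polyint_deriv p : polyint p^`() = p.[1] - p.[-1].
Proof.
have e : (antideriv p^`() - p)^`() = 0 by rewrite derivB antiderivK subrr.
rewrite /polyint -(subrK p (antideriv _)) (deriv_eq0 e) !hornerE; ring.
Qed.

Lemma polyint_by_parts p q : polyint (p^`() * q) =
  p.[1] * q.[1] - p.[-1] * q.[-1] - polyint (p * q^`()).
Proof. by rewrite -!hornerM -polyint_deriv derivM raddfD/=; ring. Qed.

(** An antiderivative of [p] is nondecreasing on [-1, 1]; were its increment zero, it
    would be constant, and [p] zero. *)
Lemma polyint_gt0 p : (forall x, -1 < x < 1 -> 0 <= p.[x]) -> p != 0 ->
  0 < polyint p.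
Proof.
move=> p_ge0 pn0; set F := antideriv p.
have F_mono x y : -1 <= x -> x <= y -> y <= 1 -> F.[x] <= F.[y].
  apply: (@ger0_derive1_ndecr _ (horner F)) => [t _|t|].
  - exact: derivable_horner.
  - by rewrite in_itv/= -derivE antiderivK; exact: p_ge0.
  - exact/continuous_subspaceT/continuous_horner.
rewrite lt_neqAle subr_ge0 F_mono ?andbT ?lexx ?(le_trans (lerN10 R) ler01)//.
apply: contra pn0; rewrite eq_sym subr_eq0 => /eqP F1.
have F_cst : F - F.[1]%:P = 0.
  apply: poly_eq0_oo => x /andP[x1 x2].
  apply/eqP; rewrite !hornerE subr_eq0 eq_le F_mono ?(ltW x1) ?(ltW x2)//=.
  by rewrite F1 F_mono// ltW.
by rewrite -(antiderivK p) -/F -(subrK F.[1]%:P F) F_cst add0r derivC.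
Qed.

End Polynomials.

(** * Jacobi polynomials with natural parameters *)

Section JacobiPolynomials.
Variable R : realType.
Implicit Types (p q r : {poly R}) (x y : R) (a b n m : nat).

Lemma size_deriv p : size p^`() = (size p).-1.
Proof.
have [->|pn0] := eqVneq p 0; first by rewrite deriv0 size_poly0.
apply/eqP; rewrite eqn_leq; apply/andP; split.
  by rewrite -ltnS prednK ?size_poly_gt0 ?lt_size_deriv.
have [/size1_polyC ->|] := leqP (size p) 1; first by rewrite size_polyC; case: eqP.
case sz: (size p) => [//|[//|m]] _ /=.
rewrite ltnNge; apply: contra pn0 => /leq_sizeP/(_ m (leqnn m))/eqP.
by rewrite coef_deriv mulrn_eq0/= -lead_coef_eq0 lead_coefE sz.
Qed.

Lemma size_derivn n p : size p^`(n) = (size p - n)%N.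
Proof.
by elim: n => [|n IH]; rewrite ?derivn0 ?subn0// derivnS size_deriv IH subnS.
Qed.

Lemma dvdp_derivn q p n m : (m <= n)%N -> q ^+ n %| p -> q ^+ (n - m) %| p^`(m).
Proof.
move=> + qp; elim: m => [_|m IH mn]; first by rewrite subn0.
have := IH (ltnW mn); rewrite -(subnSK mn); set k := (n - m.+1)%N.
move=> /dvdpP[s sE]; rewrite derivnS sE derivM deriv_exp/=.
apply: dvdp_add.
  by rewrite exprS mulrA dvdp_mull.
by rewrite -mulr_natl !mulrA dvdp_mull.
Qed.

Lemma horner_derivn_eq0 p n m x : (m < n)%N -> ('X^2 - 1) ^+ n %| p ->
  x ^+ 2 = 1 -> (p^`(m)).[x] = 0.
Proof.
move=> mn /(dvdp_derivn (ltnW mn)) /dvdpP[s ->] x1.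
by rewrite hornerM horner_exp !hornerE x1 subrr expr0n subn_eq0 leqNgt mn mulr0.
Qed.

(** Repeated integration by parts: all boundary terms vanish. *)
Lemma polyint_derivn p q n m : (m <= n)%N -> ('X^2 - 1) ^+ n %| p ->
  polyint (p^`(m) * q) = (-1) ^+ m * polyint (p * q^`(m)).
Proof.
elim: m q => [|m IH] q mn pn; first by rewrite mul1r.
rewrite derivnS polyint_by_parts !(horner_derivn_eq0 mn pn) ?sqrrN ?expr1n//.
by rewrite !mul0r subrr sub0r (IH _ (ltnW mn) pn) derivSn exprS mulN1r mulNr.
Qed.

(** The Jacobi weight, a polynomial since the parameters are natural numbers. *)
Definition wpoly a b : {poly R} := (1 - 'X) ^+ a * (1 + 'X) ^+ b.

Lemma horner_wpoly a b x : (wpoly a b).[x] = (1 - x) ^+ a * (1 + x) ^+ b.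
Proof. by rewrite /wpoly !(hornerM, horner_exp, hornerE). Qed.

Lemma wpoly_gt0 a b x : -1 < x < 1 -> 0 < (wpoly a b).[x].
Proof.
move=> /andP[x1 x2]; rewrite horner_wpoly.
by rewrite mulr_gt0// exprn_gt0//; [rewrite subr_gt0|rewrite addrC -ltrBlDr sub0r].
Qed.

Lemma wpoly_neq0 a b : wpoly a b != 0.
Proof.
apply/eqP => w0; have := @wpoly_gt0 a b 0.
by rewrite ltrN10 ltr01 w0 horner0 ltxx => /(_ isT).
Qed.

Lemma size_oneBX : size (1 - 'X : {poly R}) = 2%N.
Proof. by rewrite -size_polyN opprB -[1]/(1%:P) size_XsubC. Qed.

Lemma size_wpoly a b : size (wpoly a b) = (a + b).+1.
Proof.
have s2 : size (1 + 'X : {poly R}) = 2%N by rewrite addrC -[1]/(1%:P) size_XaddC.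
have n1 : (1 - 'X : {poly R}) != 0 by rewrite -size_poly_eq0 size_oneBX.
have n2 : (1 + 'X : {poly R}) != 0 by rewrite -size_poly_eq0 s2.
rewrite size_mul ?expf_neq0//.
rewrite (polySpred (expf_neq0 a n1)) (polySpred (expf_neq0 b n2)).
by rewrite !size_exp size_oneBX s2 !mul1n addnS.
Qed.

Lemma derive1n_poly_oo (f : R -> R) p n x :
  (forall t, -1 < t < 1 -> f t = p.[t]) -> -1 < x < 1 ->
  f^`(n)%classic x = p^`(n).[x].
Proof.
move=> fp; elim: n x => [|n IH] x x11; first by rewrite derive1n0 fp.
rewrite derive1nS derive1E (@near_eq_derive _ _ _ _ (horner p^`(n))).
  by rewrite -derive1E -derivE derivnS.
near=> t; apply: IH; near: t.
by have := @near_in_itvoo R (-1) 1 x; rewrite in_itv/=; apply.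
Unshelve. all: by end_near. Qed.

(** Rodrigues' formula as an identity of polynomials. *)
Lemma jacobi_rodrigues_poly a b n :
  (2 ^+ n * n`!%:R) *: (wpoly a b * jacobi a%:R b%:R n) =
  (wpoly a b * ('X^2 - 1) ^+ n)^`(n).
Proof.
apply/eqP; rewrite -subr_eq0; apply/eqP/poly_eq0_oo => x x11.
apply/eqP; rewrite hornerD hornerN subr_eq0 hornerZ hornerM jacobiE// /jacobi_rodrigues.
have wE t : -1 < t < 1 -> jacobi_weight a%:R b%:R t = (wpoly a b).[t].
  move=> /andP[t1 t2]; rewrite horner_wpoly /jacobi_weight !powR_mulrn//.
    by rewrite addrC -lerBlDr sub0r ltW.
  by rewrite subr_ge0 ltW.
rewrite wE// (@derive1n_poly_oo _ (wpoly a b * ('X^2 - 1) ^+ n)) => [|t t11|//].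
  rewrite mulrA mulVKf//.
  by rewrite !mulf_neq0 ?expf_neq0 ?pnatr_eq0 -?lt0n ?fact_gt0// gt_eqF// wpoly_gt0.
by rewrite wE// hornerM horner_exp !hornerE.
Qed.

Let cn (n : nat) : 2 ^+ n * n`!%:R != 0 :> R.
Proof. by rewrite mulf_neq0 ?expf_neq0 ?pnatr_eq0 -?lt0n ?fact_gt0. Qed.

(** Degrees are compared in Rodrigues' formula: [n] derivatives lower the degree
    a + b + 2n of the right-hand side by exactly [n]. *)
Lemma size_jacobi a b n : size (jacobi a%:R b%:R n : {poly R}) = n.+1.
Proof.
have := congr1 (fun p : {poly R} => size p) (jacobi_rodrigues_poly a b n).
rewrite /= size_derivn size_scale ?cn//.
have sX : size ('X^2 - 1 : {poly R}) = 3%N by rewrite -[1]/(1%:P) size_XnsubC.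
have X1 : ('X^2 - 1 : {poly R}) != 0 by rewrite -size_poly_eq0 sX.
rewrite [in RHS]size_mul ?wpoly_neq0 ?expf_neq0//.
rewrite (polySpred (expf_neq0 n X1)) size_exp sX.
have [->|Jn0] := eqVneq (jacobi a%:R b%:R n) (0 : {poly R}).
  by rewrite mulr0 size_poly0 size_wpoly; lia.
rewrite size_mul ?wpoly_neq0// size_wpoly.
by rewrite /=; move: (size _) => s; lia.
Qed.

Lemma jacobi_neq0 a b n : jacobi a%:R b%:R n != 0 :> {poly R}.
Proof. by rewrite -size_poly_eq0 size_jacobi. Qed.

Lemma jacobi_orth a b n q : (size q <= n)%N ->
  polyint (wpoly a b * jacobi a%:R b%:R n * q) = 0.
Proof.
move=> qn; apply/eqP; rewrite -(inj_eq (mulfI (cn n))) mulr0 -linearZ/=.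
rewrite scalerAl jacobi_rodrigues_poly (@polyint_derivn _ _ n) ?dvdp_mull//.
by rewrite derivn_poly0// mulr0 linear0 mulr0.
Qed.

Lemma jacobi_orth_neq a b n m : n != m ->
  polyint (wpoly a b * jacobi a%:R b%:R n * jacobi a%:R b%:R m) = 0.
Proof.
rewrite neq_ltn => /orP[nm|nm]; last by rewrite jacobi_orth// size_jacobi.
by rewrite mulrAC jacobi_orth// size_jacobi.
Qed.

Lemma polyint_wpoly_sqr_gt0 a b p : p != 0 -> 0 < polyint (wpoly a b * p * p).
Proof.
move=> pn0; apply: polyint_gt0; last first.
  by do 2?[apply: mulf_neq0 => //]; exact: wpoly_neq0.
by move=> x /(wpoly_gt0 a b) w0; rewrite 2!hornerM -mulrA -expr2 mulr_ge0 ?(ltW w0) ?sqr_ge0.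
Qed.

(** Up to a factor, the Jacobi polynomial is the only polynomial of degree at most [n]
    orthogonal to all polynomials of lower degree. *)
Lemma jacobi_orth_unique a b n q : (size q <= n.+1)%N ->
  (forall r, (size r <= n)%N -> polyint (wpoly a b * q * r) = 0) ->
  exists c, q = c *: jacobi a%:R b%:R n.
Proof.
move=> sq qorth; set J := jacobi a%:R b%:R n.
have Jn : J`_n != 0.
  by have := jacobi_neq0 a b n; rewrite -lead_coef_eq0 lead_coefE size_jacobi.
(* The constant cancels the coefficient of degree n, so that the difference d has
   degree less than n and is orthogonal to itself. *)
exists (q`_n / J`_n); set c := _ / _.
apply/eqP; rewrite -subr_eq0; set d := q - _; apply/contraT => dn0.
have sd : (size d <= n)%N.
  apply/leq_sizeP => j nj; rewrite coefB coefZ.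
  have [<-|jn] := eqVneq n j; first by rewrite /c divfK// subrr.
  have nj' : (n < j)%N by rewrite ltn_neqAle jn.
  by rewrite !nth_default ?size_jacobi ?(leq_trans sq)// mulr0 subrr.
have := polyint_wpoly_sqr_gt0 a b dn0.
have -> : wpoly a b * d * d = wpoly a b * q * d - c *: (wpoly a b * J * d).
  by rewrite /d -!mul_polyC; ring.
by rewrite linearB linearZ/= qorth// jacobi_orth// mulr0 subr0 ltxx.
Qed.

(** The antiderivative of [p] that vanishes at -1. *)
Definition primitive p : {poly R} := antideriv p - (antideriv p).[-1]%:P.

Lemma primitiveE p q : q^`() = p -> q.[-1] = 0 -> primitive p = q.
Proof.
move=> qp q1; have e : (antideriv p - q)^`() = 0 by rewrite derivB antiderivK qp subrr.
rewrite /primitive -(subrK q (antideriv p)) (deriv_eq0 e).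
by rewrite !hornerE q1 addr0 addrC addKr.
Qed.

Lemma primitiveK p : (primitive p)^`() = p.
Proof. by rewrite derivB derivC subr0 antiderivK. Qed.

Lemma primitiveN1 p : (primitive p).[-1] = 0.
Proof. by rewrite !hornerE subrr. Qed.

Lemma size_primitive p : (size (primitive p) <= (size p).+1)%N.
Proof.
rewrite -(primitiveK p) size_deriv primitiveK.
by case: (size _).
Qed.

Lemma primitiveZ c p : primitive (c *: p) = c *: primitive p.
Proof.
by apply: primitiveE; rewrite ?derivZ ?primitiveK// hornerZ primitiveN1 mulr0.
Qed.

(** Integrated Legendre polynomials are multiples of (1 - X^2) P_n^(1,1): up to
    constants, both sides are the [n]-th derivative of (X^2 - 1)^(n+1). *)
Lemma primitive_legendre n : exists2 c : R, c != 0 &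
  primitive (jacobi 0 0 n.+1) = c *: (wpoly 1 1 * jacobi 1 1 n).
Proof.
exists (- (2 ^+ n.+1 * n.+1`!%:R)^-1 * (2 ^+ n * n`!%:R)).
  by rewrite mulf_neq0 ?oppr_eq0 ?invr_neq0 ?cn.
have e0 := jacobi_rodrigues_poly 0 0 n.+1.
have e1 := jacobi_rodrigues_poly 1 1 n.
have w1 : wpoly 1 1 * ('X^2 - 1) ^+ n = - ('X^2 - 1) ^+ n.+1.
  by rewrite /wpoly !expr1 [_ ^+ n.+1]exprS; ring.
rewrite -scalerA e1 w1 derivnN scalerN scaleNr opprK.
apply: (scalerI (cn n.+1)); rewrite scalerA divff ?cn// scale1r -primitiveZ.
move: e0; rewrite /wpoly !expr0 !mul1r => ->; apply: primitiveE; first exact: derivnS.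
by apply: (@horner_derivn_eq0 _ n.+1); rewrite ?dvdpp// sqrrN expr1n.
Qed.

(** Integrated Jacobi polynomials of parameters (a+1, 0) are multiples of
    (1 + X) P_n^(a,1). *)
Lemma primitive_jacobi a n : exists2 c : R, c != 0 &
  primitive (jacobi a.+1%:R 0 n) = c *: ((1 + 'X) * jacobi a%:R 1 n).
Proof.
set K : {poly R} := (1 + 'X) * jacobi a%:R 1 n.
have n2 : (1 + 'X : {poly R}) != 0 by have := wpoly_neq0 0 1; rewrite /wpoly mul1r.
have sK : size K = n.+2.
  rewrite size_mul// ?(jacobi_neq0 a 1)// (size_jacobi a 1).
  by have := size_wpoly 0 1; rewrite /wpoly mul1r => ->.
have KN1 : K.[-1] = 0 by rewrite /K !hornerE subrr mul0r.
have [c cE] : exists c, K^`() = c *: jacobi a.+1%:R 0%:R n.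
  apply: jacobi_orth_unique; first by rewrite size_deriv sK.
  move=> r rn.
  (* After integration by parts, the derivative of r (1 - X)^(a+1) is (1 - X)^a times
     a polynomial of degree less than n, which J_n^(a,1) is orthogonal to. *)
  have -> : wpoly a.+1 0 * K^`() * r = K^`() * (r * (1 - 'X) ^+ a.+1).
    by rewrite /wpoly expr0; ring.
  have v1 : (r * (1 - 'X) ^+ a.+1).[1] = 0.
    by rewrite hornerM horner_exp !hornerE subrr expr0n mulr0.
  rewrite polyint_by_parts KN1 v1 mul0r mulr0 subr0 sub0r.
  have -> : K * (r * (1 - 'X) ^+ a.+1)^`() =
    wpoly a 1 * jacobi a%:R 1%:R n * (r^`() * (1 - 'X) - a.+1%:R%:P * r).
    rewrite /K /wpoly derivM deriv_exp derivB derivC derivX -mulr_natr exprS/=.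
    by rewrite polyC_natr; ring.
  rewrite jacobi_orth ?oppr0//.
  have [->|r0] := eqVneq r 0; first by rewrite deriv0 mulr0 mul0r subrr size_poly0.
  rewrite (leq_trans _ rn)// (leq_trans (size_polyD _ _))// size_polyN geq_max.
  rewrite mul_polyC (leq_trans (size_scale_leq _ _))// andbT.
  rewrite (leq_trans (size_polyMleq _ _))// size_oneBX.
  by rewrite addn2/= size_deriv prednK// size_poly_gt0.
have cn0 : c != 0.
  apply/eqP => c0; move: sK; move: cE; rewrite c0 scale0r => /deriv_eq0 ->.
  by rewrite size_polyC; case: eqP.
exists c^-1; first exact: invr_neq0.
rewrite -[jacobi _ _ _]/(jacobi a.+1%:R 0%:R n).
have -> : jacobi a.+1%:R 0%:R n = c^-1 *: K^`() by rewrite cE scalerK.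
by rewrite primitiveZ (primitiveE erefl).
Qed.

Lemma polyint_legendre_orth : exists c : nat -> R, (forall n, c n != 0) /\
  forall n m, polyint (primitive (jacobi 0 0 n.+1) * jacobi 1 1 m) = c n * (n == m)%:R.
Proof.
have /choice[c cE] n : exists c : R, c != 0 /\
    primitive (jacobi 0 0 n.+1) = c *: (wpoly 1 1 * jacobi 1 1 n).
  by have [c c0 cE] := primitive_legendre n; exists c.
exists (fun n => c n * polyint (wpoly 1 1 * jacobi 1 1 n * jacobi 1 1 n)); split=> [n|n m].
  by rewrite mulf_neq0 ?(cE n).1// gt_eqF// polyint_wpoly_sqr_gt0 ?(jacobi_neq0 1 1).
rewrite (cE n).2 -scalerAl linearZ/=; have [->|nm] := eqVneq n m; first by rewrite mulr1.
by rewrite (jacobi_orth_neq 1 1 nm) !mulr0.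
Qed.

Lemma polyint_jacobi_orth : exists c : nat -> nat -> R, (forall a n, c a n != 0) /\
  forall a n m, polyint ((1 - 'X) ^+ a * primitive (jacobi a.+1%:R 0 n) * jacobi a%:R 1 m)
    = c a n * (n == m)%:R.
Proof.
have /choice[c cE] (an : nat * nat) : exists c : R, c != 0 /\
    primitive (jacobi an.1.+1%:R 0 an.2) = c *: ((1 + 'X) * jacobi an.1%:R 1 an.2).
  by have [c c0 cE] := primitive_jacobi an.1 an.2; exists c.
exists (fun a n => c (a, n) * polyint (wpoly a 1 * jacobi a%:R 1 n * jacobi a%:R 1 n)).
split=> [a n|a n m].
  by rewrite mulf_neq0 ?(cE (a, n)).1// gt_eqF// polyint_wpoly_sqr_gt0 ?(jacobi_neq0 a 1).
rewrite (cE (a, n)).2 -scalerAr -scalerAl linearZ/= mulrA -[_ * (1 + 'X)]/(wpoly a 1).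
have [->|nm] := eqVneq n m; first by rewrite mulr1.
by rewrite (jacobi_orth_neq a 1 nm) !mulr0.
Qed.

End JacobiPolynomials.

(** * Homogenization *)

Section Homogenization.
Variable R : realType.
Implicit Types (A B : {poly R}) (x y h c : R) (d e : nat).

(** A(x / h) h^d as a polynomial in x, for a fixed value of h; the formula also makes
    sense for h = 0. *)
Definition homog d A h : {poly R} := \poly_(i < d.+1) (A`_i * h ^+ (d - i)).

Lemma homog_scale d A h c : (size A <= d.+1)%N ->
  (homog d A h).[c * h] = A.[c] * h ^+ d.
Proof.
move=> sA; rewrite horner_poly (horner_coef_wide _ sA) mulr_suml.
apply: eq_bigr => i _.
have -> : h ^+ d = h ^+ (d - i) * h ^+ i by rewrite -exprD subnK// -ltnS.
by rewrite exprMn; ring.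
Qed.

Lemma homog00 d A : (0 < d)%N -> (homog d A 0).[0] = 0.
Proof.
move=> d0; rewrite horner_poly big1// => i _; rewrite -mulrA -exprD expr0n.
by rewrite subnK ?(gtn_eqF d0) ?mulr0// -ltnS.
Qed.

(** When h = 0 the hypothesis forces x = 0 and both sides vanish; this is where the
    convention x / 0 = 0 agrees with the homogenization. *)
Lemma homog_div d A h x : (0 < d)%N -> (size A <= d.+1)%N -> `|x| <= h ->
  (homog d A h).[x] = A.[x / h] * h ^+ d.
Proof.
move=> d0 sA; have [->|h0 _] := eqVneq h 0.
  by rewrite normr_le0 => /eqP ->; rewrite homog00// expr0n gtn_eqF// mulr0.
by rewrite -{1}(divfK h0 x) homog_scale.
Qed.

Lemma homogZ d A h c : homog d (c *: A) h = c *: homog d A h.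
Proof.
apply/polyP => i; rewrite coefZ !coef_poly coefZ.
by case: ifP => _; rewrite ?mulr0// mulrA.
Qed.

Lemma homog_antideriv d A h : (homog d.+1 (antideriv A) h)^`() = homog d A h.
Proof.
apply/polyP => i; rewrite coef_deriv [X in X *+ _]coef_poly [RHS]coef_poly ltnS.
case: ifP => _; last exact: mul0rn.
by rewrite coef_antideriv/= subSS -[LHS]mulr_natr mulrAC divfK.
Qed.

Lemma normr_homog_le d A h x : `|x| <= h -> h <= 1 ->
  `|(homog d A h).[x]| <= \sum_(i < d.+1) `|A`_i|.
Proof.
move=> xh h1; have h0 : 0 <= h := le_trans (normr_ge0 x) xh.
rewrite horner_poly (le_trans (ler_norm_sum _ _ _))//; apply: ler_sum => i _.
rewrite !normrM -mulrA ler_piMr// !normrX (ger0_norm h0).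
by rewrite mulr_ile1 ?exprn_ge0 ?exprn_ile1// (le_trans xh).
Qed.

Lemma measurable_homog d A (d' : measure_display) (T : measurableType d')
    (D : set T) (f g : T -> R) :
  measurable_fun D f -> measurable_fun D g ->
  measurable_fun D (fun t => (homog d A (g t)).[f t]).
Proof.
move=> mf mg; under eq_fun do rewrite horner_poly.
apply: measurable_sum => i; apply: measurable_funM; last exact: measurable_funX.
by apply: measurable_funM; [exact: measurable_cst|exact: measurable_funX].
Qed.

End Homogenization.

(** * One-dimensional integrals and slices *)

Section Integrals.
Variable R : realType.
Local Notation mu := (@lebesgue_measure R).
Implicit Types (A B : {poly R}) (x y h c : R) (d e : nat).

Lemma integral_deriv_poly (F : {poly R}) x y : x <= y ->
  (\int[mu]_(t in `[x, y]) (F^`().[t])%:E)%E = (F.[y] - F.[x])%:E.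
Proof.
rewrite le_eqVlt => /predU1P[->|xy].
  by rewrite set_itv1 integral_set1 subrr.
rewrite (@continuous_FTC2 _ _ (horner F))//.
- exact/continuous_subspaceT/continuous_horner.
- split => [t _||]; first exact: derivable_horner.
  + by apply: cvg_at_right_filter; exact: continuous_horner.
  + by apply: cvg_at_left_filter; exact: continuous_horner.
- by move=> t _; rewrite derivE.
Qed.

Lemma integral_polyint A : (\int[mu]_(t in `[(-1)%R, 1%R]) (A.[t])%:E)%E = (polyint A)%:E.
Proof. by rewrite -{1}(antiderivK A) integral_deriv_poly// (le_trans (lerN10 R)). Qed.

Lemma int_jacobiE (a : R) n x : -1 <= x ->
  int_jacobi a n x = (primitive (jacobi a 0 n.-1)).[x].
Proof.
move=> x1; rewrite /int_jacobi /Rintegral.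
by rewrite -{1}(primitiveK (jacobi a 0 n.-1)) integral_deriv_poly//= primitiveN1 subr0.
Qed.

(** The substitution x = s h, which also holds for h = 0. *)
Lemma integral_homog d A h : (size A <= d.+1)%N -> 0 <= h ->
  (\int[mu]_(x in `[(- h)%R, h]) ((homog d A h).[x])%:E)%E = (polyint A * h ^+ d.+1)%:E.
Proof.
move=> sA h0; rewrite -(homog_antideriv d A h) integral_deriv_poly ?ge0_cp//.
have s' : (size (antideriv A) <= d.+2)%N by rewrite (leq_trans (size_poly _ _)).
rewrite -{2}[h]mul1r -[X in _ - _.[X]]mulN1r !homog_scale//.
by rewrite -mulrBl.
Qed.

(** Fubini's theorem for a domain described by its slices [S y], y in [[a, b]]. *)
Lemma integral_slices (d : measure_display) (T : measurableType d)
    (m : {sigma_finite_measure set T -> \bar R}) (D : set (T * measurableTypeR R))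
    (S : R -> set T) (a b : R) (f : T * measurableTypeR R -> R) :
  measurable D -> (forall t y, D (t, y) <-> y \in `[a, b] /\ S y t) ->
  (m \x mu)%E.-integrable D (EFin \o f) ->
  (\int[m \x mu]_(p in D) (f p)%:E =
   \int[mu]_(y in `[a, b]) \int[m]_(t in S y) (f (t, y))%:E)%E.
Proof.
move=> mD DS intf; rewrite integral_mkcond.
rewrite -[LHS]integral21_prod_meas1; last exact: (integrable_mkcond _ mD).1.
rewrite [RHS]integral_mkcond; apply: eq_integral => y _; rewrite [RHS]patchE.
rewrite /fubini_G.
case: ifPn => [|/negP yab].
  rewrite inE => yab.
  rewrite [RHS]integral_mkcond; apply: eq_integral => t _; rewrite !patchE.
  congr (if _ then _ else _); apply/idP/idP; rewrite !inE; first by move/DS => [].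
  by move=> St; apply/DS; split.
apply: integral0_eq => t _; rewrite patchE ifN//; apply/negP; rewrite inE => /DS[yab' _].
by apply: yab; rewrite inE.
Qed.

End Integrals.

(** * The triangle and the tetrahedron *)

Section Domains.
Variable R : realType.
Local Notation mu := (@lebesgue_measure R).
Local Notation TR := (measurableTypeR R).
Implicit Types (A B C : {poly R}) (x y z h c : R) (d e : nat).

(** The measurable structure carried by the Lebesgue measure and the default one of
    [R] have the same measurable sets but are distinct structures: the projections
    are measurable from the former to the latter. *)
Lemma measurable_fstR (d : measure_display) (T : measurableType d) :
  measurable_fun [set: TR * T] (fun p => p.1 : R).
Proof. by move=> mD Y mY; exact: measurable_fst. Qed.

Lemma measurable_sndR (d : measure_display) (T : measurableType d) :
  measurable_fun [set: T * TR] (fun p => p.2 : R).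
Proof. by move=> mD Y mY; exact: measurable_snd. Qed.

Lemma measurable_set_ler (d : measure_display) (T : measurableType d) (f g : T -> R) :
  measurable_fun setT f -> measurable_fun setT g -> measurable [set p | f p <= g p].
Proof.
move=> mf mg; have := measurable_fun_ler mf mg.
by move=> /(_ measurableT [set true] I); rewrite setTI.
Qed.

(** The triangle of vertices (-h, -h), (h, -h), (0, h) when [0 <= h]; it is empty when
    [h < 0], and [h = 1] gives the triangle of the statement. *)
Definition scaled_triangle h : set (TR * TR) :=
  [set p | - h <= p.2 /\ `|p.1| <= (h - p.2) / 2].

(** The tetrahedron of the statement: its slice at height z is the triangle scaled by
    (1 - z) / 2. *)
Definition std_tetra : set (TR * TR * TR) :=
  [set p | -1 <= p.2 /\ scaled_triangle ((1 - p.2) / 2) p.1].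

Lemma measurable_scaled_triangle h : measurable (scaled_triangle h).
Proof.
apply: measurableI; apply: measurable_set_ler.
- exact: measurable_cst.
- exact: measurable_sndR.
- by apply: measurableT_comp => //; exact: measurable_fstR.
- apply: measurable_funM; last exact: measurable_cst.
  by apply: measurable_funB; [exact: measurable_cst|exact: measurable_sndR].
Qed.

Lemma scaled_triangle_bounds h p :
  scaled_triangle h p -> `|p.1| <= h /\ `|p.2| <= h.
Proof.
move: p => [x y] [/= y1 x1]; have h0 := le_trans (normr_ge0 x) x1.
have yh : `|y| <= h by rewrite ler_norml y1; lra.
by split=> //; rewrite (le_trans x1)//; lra.
Qed.

Lemma std_tetra_bounds p :
  std_tetra p -> [/\ `|p.1.1| <= 1, `|p.1.2| <= 1 & `|p.2| <= 1].
Proof.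
move: p => [p z] [/= z1] /scaled_triangle_bounds[x y].
have h0 := le_trans (normr_ge0 _) y.
split; [rewrite (le_trans x)//|rewrite (le_trans y)//|rewrite ler_norml z1]; lra.
Qed.

Lemma measurable_coords3 :
  [/\ measurable_fun [set: TR * TR * TR] (fun p => p.1.1 : R),
      measurable_fun [set: TR * TR * TR] (fun p => p.1.2 : R),
      measurable_fun [set: TR * TR * TR] (fun p => p.2 : R) &
      measurable_fun [set: TR * TR * TR] (fun p => (1 - p.2) / 2 : R)].
Proof.
split.
- by apply: (measurableT_comp (@measurable_fstR _ TR)); exact: measurable_fst.
- by apply: (measurableT_comp (@measurable_sndR _ TR)); exact: measurable_fst.
- exact: measurable_sndR.
- apply: measurable_funM; last exact: measurable_cst.
  by apply: measurable_funB; [exact: measurable_cst|exact: measurable_sndR].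
Qed.

Lemma measurable_std_tetra : measurable std_tetra.
Proof.
have [m1 m2 m3 mh] := measurable_coords3.
apply: measurableI; first by apply: measurable_set_ler; [exact: measurable_cst|].
apply: measurableI; apply: measurable_set_ler => //.
- exact: measurableT_comp.
- exact: measurableT_comp.
- apply: measurable_funM; last exact: measurable_cst.
  exact: measurable_funB.
Qed.

Lemma mu_itv11 : (mu `[(-1)%R, 1%R] < +oo)%E.
Proof. by rewrite lebesgue_measure_itv/= lte_fin; case: ifP => _ //; rewrite ltry. Qed.

Lemma scaled_triangle_fin h : h <= 1 -> ((mu \x mu)%E (scaled_triangle h) < +oo)%E.
Proof.
move=> h1; apply: (@le_lt_trans _ _ ((mu \x mu)%E (`[-1, 1] `*` `[-1, 1]))).
  apply: le_measure; rewrite ?inE.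
  - exact: measurable_scaled_triangle.
  - exact: measurableX.
  - move=> p /scaled_triangle_bounds[x y].
    by split; rewrite /= in_itv/= -ler_norml (le_trans _ h1).
by rewrite product_measure1E// lte_mul_pinfty ?ge0_fin_numE ?mu_itv11.
Qed.

Lemma std_tetra_fin : (((mu \x mu) \x mu)%E std_tetra < +oo)%E.
Proof.
apply: (@le_lt_trans _ _ (((mu \x mu) \x mu)%E ((`[-1, 1] `*` `[-1, 1]) `*` `[-1, 1]))).
  apply: le_measure; rewrite ?inE.
  - exact: measurable_std_tetra.
  - by apply: measurableX => //; exact: measurableX.
  - by move=> p /std_tetra_bounds[x y z]; do 2?split; rewrite /= in_itv/= -ler_norml.
have f2 : ((mu \x mu)%E (`[(-1)%R, 1%R] `*` `[(-1)%R, 1%R]) < +oo)%E.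
  by rewrite product_measure1E// lte_mul_pinfty ?ge0_fin_numE ?mu_itv11.
rewrite product_measure1E//; last exact: measurableX.
by rewrite lte_mul_pinfty ?ge0_fin_numE ?mu_itv11.
Qed.

Lemma bounded_integrable (d : measure_display) (T : measurableType d)
    (m : {measure set T -> \bar R}) (D : set T) (f : T -> R) (M : R) :
  measurable D -> (m D < +oo)%E -> measurable_fun D f ->
  (forall t, D t -> `|f t| <= M) -> m.-integrable D (EFin \o f).
Proof.
move=> mD fD mf fM; apply: measurable_bounded_integrable => //.
by exists M; split; [exact: num_real|move=> N MN t Dt; exact: le_trans (fM t Dt) (ltW MN)].
Qed.

(** The polynomial (1 - X) / 2. *)
Definition halfp : {poly R} := 2^-1 *: (1 - 'X).

Lemma horner_halfp x : halfp.[x] = (1 - x) / 2.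
Proof. by rewrite !hornerE mulrC. Qed.

(** The function A(x / w) w^d B(y / h) h^e with w = (h - y) / 2, homogenized. *)
Definition tri_fun d e A B h (p : TR * TR) : R :=
  (homog d A ((h - p.2) / 2)).[p.1] * (homog e B h).[p.2].

Lemma measurable_tri_fun d e A B h D : measurable_fun D (tri_fun d e A B h).
Proof.
apply: measurable_funTS; apply: measurable_funM.
  apply: (@measurable_homog R d A _ _ setT (fun p : TR * TR => p.1) (fun p => (h - p.2) / 2)).
    exact: measurable_fstR.
  apply: measurable_funM; last exact: measurable_cst.
  by apply: measurable_funB; [exact: measurable_cst|exact: measurable_sndR].
apply: (@measurable_homog R e B _ _ setT (fun p : TR * TR => p.2) (fun=> h)).
  exact: measurable_sndR.
exact: measurable_cst.
Qed.

Lemma tri_fun_bound d e A B h p : h <= 1 -> scaled_triangle h p ->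
  `|tri_fun d e A B h p| <= (\sum_(i < d.+1) `|A`_i|) * (\sum_(i < e.+1) `|B`_i|).
Proof.
move=> h1 sp; have [x y] := scaled_triangle_bounds sp.
rewrite normrM ler_pM// normr_homog_le//.
  by case: sp.
by move: y; rewrite ler_norml => /andP[y1 y2]; lra.
Qed.

Lemma size_halfp_expM n B e : (size B <= e.+1)%N ->
  (size (halfp ^+ n * B)%R <= (n + e).+1)%N.
Proof.
move=> sB; rewrite (leq_trans (size_polyMleq _ _))//.
have s2 : (size halfp <= 2)%N.
  by rewrite (leq_trans (size_scale_leq _ _))// size_oneBX.
have sn : (size (halfp ^+ n) <= n.+1)%N.
  rewrite (leq_trans (size_poly_exp_leq _ _))// ltnS -{2}[n]mul1n leq_mul2r.
  by apply/orP; right; move: s2; case: (size halfp).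
by move: sn sB; move: (size _) (size _) => s3 s4; lia.
Qed.

(** The Jacobian and the powers of (h - y) / 2, absorbed in the polynomial in y. *)
Lemma homog_halfp d e B h y : - h <= y <= h -> (size B <= e.+1)%N ->
  (homog (d.+1 + e) (halfp ^+ d.+1 * B) h).[y] =
  ((h - y) / 2) ^+ d.+1 * (homog e B h).[y].
Proof.
move=> yh sB; have [h0|h0] := eqVneq h 0.
  have -> : y = 0 by move: yh; rewrite h0; lra.
  by rewrite h0 homog00// subrr mul0r exprS !mul0r.
rewrite -(divfK h0 y); set c := y / h.
rewrite !homog_scale ?size_halfp_expM// hornerM horner_exp horner_halfp exprD mulrACA.
by congr (_ * _); rewrite -exprMn; congr (_ ^+ _); ring.
Qed.

(** The integral over a triangle factors in the coordinates (x / w, y / h). *)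
Lemma integral_scaled_triangle d e A B h : (size A <= d.+1)%N -> (size B <= e.+1)%N ->
  0 <= h <= 1 ->
  (\int[mu \x mu]_(p in scaled_triangle h) (tri_fun d e A B h p)%:E)%E =
  (polyint A * polyint (halfp ^+ d.+1 * B) * h ^+ (d + e).+2)%:E.
Proof.
move=> sA sB /andP[h0 h1].
rewrite (@integral_slices _ _ _ mu _ 
  (fun y => `[- ((h - y) / 2), (h - y) / 2]%classic) (- h) h).
- under eq_integral => y yh.
    rewrite /tri_fun/=.
    have yh' : - h <= y <= h by move: yh; rewrite inE/= in_itv.
    under eq_integral do rewrite mulrC -hornerZ -homogZ.
    rewrite integral_homog ?(leq_trans (size_scale_leq _ _))//; last by lra.
    rewrite linearZ/= -mulrA.
    have -> : (homog e B h).[y] * (polyint A * ((h - y) / 2) ^+ d.+1) =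
       (homog (d.+1 + e) (polyint A *: (halfp ^+ d.+1 * B)) h).[y].
      by rewrite homogZ hornerZ homog_halfp//; ring.
    over.
  rewrite integral_homog ?(leq_trans (size_scale_leq _ _)) ?size_halfp_expM//.
  by rewrite linearZ.
- exact: measurable_scaled_triangle.
- move=> x y; rewrite /scaled_triangle/= !in_itv/= -!ler_norml; split=> [sp|[yh xh]].
    by have [_ y1] := @scaled_triangle_bounds h (x, y) sp; case: sp.
  by split=> //; move: yh; rewrite ler_norml => /andP[].
- apply: (@bounded_integrable _ _ _ _ _
    ((\sum_(i < d.+1) `|A`_i|) * (\sum_(i < e.+1) `|B`_i|))).
  + exact: measurable_scaled_triangle.
  + exact: scaled_triangle_fin.
  + exact: measurable_tri_fun.
  + by move=> p; exact: tri_fun_bound.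
Qed.
End Domains.

(** The Lebesgue measure on the plane, named so as to carry the structure of a
    sigma-finite measure that Fubini's theorem in space requires. *)
Definition leb2 (R : realType) :
    set (measurableTypeR R * measurableTypeR R)%type -> \bar R :=
  (@lebesgue_measure R \x @lebesgue_measure R)%E.

HB.instance Definition _ (R : realType) := Measure.on (@leb2 R).

Lemma leb2_sigma_finite (R : realType) : sigma_finite setT (@leb2 R).
Proof.
exists (fun n => `[- n%:R, n%:R] `*` `[- n%:R, n%:R]).
  apply/esym/seteqP; split=> // -[x y] _.
  exists (Num.truncn (`|x| + `|y|)).+1 => //.
  have := Num.Theory.truncnS_gt (`|x| + `|y|); set N := _%:R => xyN.
  have := normr_ge0 x; have := normr_ge0 y => y0 x0.
  by split; rewrite /= in_itv/= -ler_norml; lra.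
move=> n; split; first exact: measurableX.
have fin : (@lebesgue_measure R `[(- n%:R)%R, n%:R] < +oo)%E.
  by rewrite lebesgue_measure_itv/= lte_fin; case: ifP => _ //; rewrite ltry.
by rewrite /leb2 product_measure1E// lte_mul_pinfty// ge0_fin_numE.
Qed.

HB.instance Definition _ (R : realType) :=
  Measure_isSigmaFinite.Build _ _ _ (@leb2 R) (@leb2_sigma_finite R).

Section Tetrahedron.
Variable R : realType.
Local Notation mu := (@lebesgue_measure R).
Local Notation TR := (measurableTypeR R).
Implicit Types (A B C : {poly R}) (x y z h c : R) (d e : nat).

(** [tri_fun] at height h = (1 - z) / 2, times a polynomial in z. *)
Definition tet_fun d e A B C (p : TR * TR * TR) : R :=
  tri_fun d e A B ((1 - p.2) / 2) p.1 * C.[p.2].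

Lemma measurable_tet_fun d e A B C D : measurable_fun D (tet_fun d e A B C).
Proof.
have [m1 m2 m3 mh] := measurable_coords3 R.
apply: measurable_funTS; apply: measurable_funM; last first.
  apply: (measurableT_comp (f := horner C)) => //.
  exact: continuous_measurable_fun (@continuous_horner R C).
apply: measurable_funM.
  apply: (@measurable_homog R d A _ _ setT (fun p : TR * TR * TR => p.1.1)
    (fun p => ((1 - p.2) / 2 - p.1.2) / 2)) => //.
  apply: measurable_funM; last exact: measurable_cst.
  exact: measurable_funB.
exact: (@measurable_homog R e B _ _ setT (fun p : TR * TR * TR => p.1.2)
  (fun p => (1 - p.2) / 2)).
Qed.

(** The integral over the slice at height z is C(z) ((1 - z) / 2)^(d+e+2) times two
    factors that do not depend on z. *)
Lemma integral_std_tetra d e A B C : (size A <= d.+1)%N -> (size B <= e.+1)%N ->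
  (\int[(mu \x mu) \x mu]_(p in @std_tetra R) (tet_fun d e A B C p)%:E)%E =
  (polyint A * polyint (halfp R ^+ d.+1 * B) * polyint (halfp R ^+ (d + e).+2 * C))%:E.
Proof.
move=> sA sB.
rewrite (@integral_slices _ _ _ (@leb2 R) _
  (fun z => scaled_triangle ((1 - z) / 2)) (-1) 1).
- transitivity (\int[mu]_(z in `[(-1)%R, 1%R])
      ((polyint A * polyint (halfp R ^+ d.+1 * B)) *:
         (halfp R ^+ (d + e).+2 * C)).[z]%:E)%E; last first.
    by rewrite integral_polyint linearZ.
  apply: eq_integral => z zh.
  have zh' : 0 <= (1 - z) / 2 <= 1 by move: zh; rewrite inE/= in_itv/= => /andP[? ?]; lra.
  transitivity (\int[mu \x mu]_(p in scaled_triangle ((1 - z) / 2))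
      (tri_fun d e (C.[z] *: A) B ((1 - z) / 2) p)%:E)%E.
    by apply: eq_integral => p _; congr EFin; rewrite /tet_fun /tri_fun/= homogZ hornerZ; ring.
  rewrite integral_scaled_triangle ?(leq_trans (size_scale_leq _ _))//.
  by rewrite linearZ/= hornerZ hornerM horner_exp horner_halfp; congr EFin; ring.
- exact: measurable_std_tetra.
- move=> p z; rewrite /std_tetra/= !in_itv/=; split=> [sp|[/andP[]]//].
  have [_ _ /= z1] := @std_tetra_bounds R (p, z) sp; split; last by case: sp.
  by rewrite -ler_norml.
- apply: (@bounded_integrable _ _ _ _ _ _
    ((\sum_(i < d.+1) `|A`_i|) * (\sum_(i < e.+1) `|B`_i|) *
    (\sum_(i < (size C).+1) `|C`_i|))).
  + exact: measurable_std_tetra.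
  + exact: std_tetra_fin.
  + exact: measurable_tet_fun.
  + move=> p sp; have [_ _ z] := std_tetra_bounds sp.
    rewrite normrM ler_pM// ?tri_fun_bound//.
    * by move: z; rewrite ler_norml => /andP[? ?]; lra.
    * by case: sp.
    * have := @homog_scale R (size C) C 1 p.2 (leqnSn _).
      by rewrite mulr1 expr1n mulr1 => <-; rewrite normr_homog_le.
Qed.

Lemma triangleE : triangle R = @scaled_triangle R 1.
Proof.
apply/seteqP; split=> [[x y] [w [w0 w1]]|[x y] [/= y1]].
  rewrite !big_ord_recl big_ord0 !(tnth_nth 0)/= => -[-> ->].
  move: w1; rewrite !big_ord_recl big_ord0.
  have := w0 ord0; have := w0 (lift ord0 ord0); have := w0 (lift ord0 (lift ord0 ord0)).
  rewrite /scaled_triangle /GRing.scale/=.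
  move: (w _) (w _) (w _) => a b c a0 b0 c0 abc; split; first by lra.
  by rewrite ler_norml; lra.
rewrite ler_norml => /andP[x1 x2].
(* Barycentric coordinates of (x, y). *)
exists (fun i => nth 0
  [:: ((1 - y) / 2 - x) / 2; ((1 - y) / 2 + x) / 2; (1 + y) / 2] i); split.
- by move=> [[|[|[|//]]]] /= _; lra.
- by rewrite !big_ord_recl big_ord0/=; field.
- rewrite !big_ord_recl big_ord0 !(tnth_nth 0)/=.
  by congr (_, _); rewrite /= /GRing.scale/=; field.
Qed.

Lemma tetrahedronE : tetrahedron R = @std_tetra R.
Proof.
apply/seteqP; split=> [[[x y] z] [w [w0 w1]]|[[x y] z] [/= z1 [/= y1]]].
  rewrite !big_ord_recl big_ord0 !(tnth_nth 0)/= => -[-> -> ->].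
  move: w1; rewrite !big_ord_recl big_ord0.
  have := w0 ord0; have := w0 (lift ord0 ord0); have := w0 (lift ord0 (lift ord0 ord0)).
  have := w0 (lift ord0 (lift ord0 (lift ord0 ord0))).
  rewrite /std_tetra /scaled_triangle /GRing.scale/=.
  move: (w _) (w _) (w _) (w _) => a b c d a0 b0 c0 d0 abc; split; first by lra.
  by split; [lra|rewrite ler_norml; lra].
rewrite ler_norml => /andP[x1 x2].
pose H := (1 - z) / 2.
(* Barycentric coordinates of (x, y, z). *)
exists (fun i => nth 0
  [:: ((H - y) / 2 - x) / 2; ((H - y) / 2 + x) / 2; (y + H) / 2; (1 + z) / 2] i); split.
- by rewrite /H; move=> [[|[|[|[|//]]]]] /= _; lra.
- by rewrite !big_ord_recl big_ord0/= /H; field.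
- rewrite !big_ord_recl big_ord0 !(tnth_nth 0)/=.
  by congr (_, _, _); rewrite /= /GRing.scale/= /H; field.
Qed.

Lemma normr_div_le1 x w : `|x| <= w -> `|x / w| <= 1.
Proof.
move=> xw; have := le_trans (normr_ge0 x) xw.
rewrite le_eqVlt => /predU1P[<-|w0]; first by rewrite invr0 mulr0 normr0.
by rewrite normf_div (gtr0_norm w0) ler_pdivrMr// mul1r.
Qed.

(** * Biorthogonality *)

(** The factor in s of the product of the [i]-th and [k]-th functions. *)
Definition xpoly i k : {poly R} := primitive (jacobi 0 0 i.-1) * jacobi 1 1 (k - 2).

(** The factor in y (or z): Phat_j^a P_(l-1)^(b,1). *)
Definition ypoly (a b : R) j l : {poly R} :=
  primitive (jacobi a 0 j.-1) * jacobi b 1 (l - 1).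

Lemma size_ypoly a b j l : (1 <= j)%N -> (1 <= l)%N ->
  (size (ypoly a%:R b%:R j l) <= (j + (l - 1)).+1)%N.
Proof.
move=> j1 l1; rewrite (leq_trans (size_polyMleq _ _))// (size_jacobi R b 1).
have := size_primitive (jacobi a%:R 0%:R j.-1 : {poly R}); rewrite size_jacobi.
by move: (size _) => s; lia.
Qed.

Lemma size_xpoly i k : (2 <= i)%N -> (2 <= k)%N ->
  (size (xpoly i k) <= (i + (k - 2)).+1)%N.
Proof.
move=> i1 k1; rewrite (leq_trans (size_polyMleq _ _))// (size_jacobi R 1 1).
have := size_primitive (jacobi 0%:R 0%:R i.-1 : {poly R}); rewrite size_jacobi.
by move: (size _) => s; lia.
Qed.

(** On the domain, the product of the two functions of (x, y) is the polynomial
    function [tri_fun], also where a denominator vanishes. *)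
Lemma tri_funE i j k l a b h x y :
  (2 <= i)%N -> (1 <= j)%N -> (2 <= k)%N -> (1 <= l)%N ->
  scaled_triangle h (x, y) -> let w := (h - y) / 2 in
  int_legendre i (x / w) * w ^+ i * int_jacobi a%:R j (y / h) * h ^+ j *
  ((jacobi 1 1 (k - 2)).[x / w] * w ^+ (k - 2) *
   (jacobi b%:R 1 (l - 1)).[y / h] * h ^+ (l - 1)) =
  tri_fun (i + (k - 2)) (j + (l - 1)) (xpoly i k) (ypoly a%:R b%:R j l) h (x, y).
Proof.
move=> i2 j1 k2 l1 s w; have [_ yh] := scaled_triangle_bounds s; have [/= _ xw] := s.
have dx : (0 < i + (k - 2))%N by rewrite addn_gt0 (ltnW i2).
have dy : (0 < j + (l - 1))%N by rewrite addn_gt0 j1.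
rewrite /tri_fun (homog_div dx (size_xpoly i2 k2) xw).
rewrite (homog_div dy (size_ypoly a b j1 l1) yh).
have x1 := normr_div_le1 xw; have y1 := normr_div_le1 yh.
rewrite /int_legendre !int_jacobiE; first last.
  - by move: x1; rewrite ler_norml => /andP[].
  - by move: y1; rewrite ler_norml => /andP[].
by rewrite /xpoly /ypoly !hornerM !exprD; ring.
Qed.

Lemma polyint_xpoly : exists c : nat -> R, (forall i, c i != 0) /\
  forall i k, (2 <= i)%N -> (2 <= k)%N -> polyint (xpoly i k) = c i * (i == k)%:R.
Proof.
have [c [c0 cE]] := polyint_legendre_orth R; exists (fun i => c (i - 2)%N).
by split=> // -[|[|i]] [|[|k]]// _ _; rewrite /xpoly !subSS !subn0 cE.
Qed.

Lemma polyint_ypoly : exists c : nat -> nat -> R, (forall a j, c a j != 0) /\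
  forall a a' n j l, (1 <= j)%N -> (1 <= l)%N -> a' = a.+1 -> n = a ->
    polyint (halfp R ^+ n * ypoly a'%:R a%:R j l) = c a j * (j == l)%:R.
Proof.
have [c [c0 cE]] := polyint_jacobi_orth R.
exists (fun a j => (2^-1) ^+ a * c a j.-1); split=> [a j|a _ _ [//|j] [//|l] _ _ -> ->].
  by rewrite mulf_neq0 ?expf_neq0 ?invr_eq0.
by rewrite /ypoly exprZn -scalerAl linearZ/= mulrA cE subn1 mulrA.
Qed.

End Tetrahedron.


Theorem lemma3p1 (R : realType) :
  (exists c : nat -> nat -> R,
    (forall i j : nat, (2 <= i)%N -> (1 <= j)%N -> c i j != 0) /\
    (forall i j k l : nat,
      (2 <= i)%N -> (1 <= j)%N -> (2 <= k)%N -> (1 <= l)%N ->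
      (\int[@lebesgue_measure R \x @lebesgue_measure R]_(p in triangle R)
        (u_tri i j p * b_tri k l p)%:E)%E =
      (c i j * (i == k)%:R * (j == l)%:R)%:E)) /\
  (exists c : nat -> nat -> nat -> R,
    (forall i j k : nat, (2 <= i)%N -> (1 <= j)%N -> (1 <= k)%N ->
      c i j k != 0) /\
    (forall i j k l n m : nat,
      (2 <= i)%N -> (1 <= j)%N -> (1 <= k)%N ->
      (2 <= l)%N -> (1 <= n)%N -> (1 <= m)%N ->
      (\int[(@lebesgue_measure R \x @lebesgue_measure R)
              \x @lebesgue_measure R]_(p in tetrahedron R)
        (u_tet i j k p * b_tet l n m p)%:E)%E =
      (c i j k * (i == l)%:R * (j == n)%:R * (k == m)%:R)%:E)).
Proof.
have [cx [cx0 cxE]] := polyint_xpoly R; have [cy [cy0 cyE]] := polyint_ypoly R.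
have even_natr i : 2 * i%:R = (2 * i)%:R :> R by rewrite natrM.
have odd_natr i : (1 <= i)%N -> 2 * i%:R - 1 = (2 * i - 1)%:R :> R.
  by move=> i1; rewrite natrB ?natrM// muln_gt0.
split.
- exists (fun i j => cx i * cy (2 * i - 1)%N j); split=> [i j _ _|i j k l i2 j1 k2 l1].
    by rewrite mulf_neq0.
  transitivity (\int[@lebesgue_measure R \x @lebesgue_measure R]_(p in @scaled_triangle R 1)
    (tri_fun (i + (k - 2)) (j + (l - 1)) (xpoly R i k)
       (ypoly (2 * i)%:R (2 * k - 1)%:R j l) 1 p)%:E)%E.
    rewrite triangleE; apply: eq_integral => -[x y]; rewrite inE => s; congr EFin.
    rewrite -tri_funE// /u_tri /b_tri even_natr odd_natr ?(ltnW k2)//.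
    have -> : 2 * x / (1 - y) = x / ((1 - y) / 2) by rewrite invfM invrK; ring.
    by rewrite divr1 !expr1n !mulr1.
  have h1 : 0 <= (1 : R) <= 1 by rewrite ler01 lexx.
  rewrite (integral_scaled_triangle (size_xpoly R i2 k2) (size_ypoly R _ _ j1 l1) h1).
  rewrite expr1n mulr1 cxE//.
  have [<-|_] := eqVneq i k; last by rewrite !mulr0 !mul0r.
  by rewrite cyE// ?mulr1 ?mulrA//; lia.
- exists (fun i j k => cx i * cy (2 * i - 1)%N j * cy (2 * i + 2 * j - 1)%N k).
  split=> [i j k _ _ _|i j k l n m i2 j1 k1 l2 n1 m1].
    by rewrite !mulf_neq0.
  transitivity (\int[(@lebesgue_measure R \x @lebesgue_measure R)
              \x @lebesgue_measure R]_(p in @std_tetra R)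
    (tet_fun (i + (l - 2)) (j + (n - 1)) (xpoly R i l)
       (ypoly (2 * i)%:R (2 * l - 1)%:R j n)
       (ypoly (2 * i + 2 * j)%:R (2 * l + 2 * n - 1)%:R k m) p)%:E)%E.
    rewrite tetrahedronE; apply: eq_integral => -[[x y] z]; rewrite inE => s; congr EFin.
    have [_ _ /= z1] := std_tetra_bounds s; have {s} [_ /= s] := s.
    rewrite /tet_fun /= -tri_funE//; set h := (1 - z) / 2; set w := (h - y) / 2.
    rewrite /ypoly hornerM -int_jacobiE; last by move: z1; rewrite ler_norml => /andP[].
    rewrite /u_tet /b_tet.
    have -> : (1 - 2 * y - z) / 4 = w by rewrite /w /h; field.
    have -> : 4 * x / (1 - 2 * y - z) = x / w.
      have -> : 1 - 2 * y - z = 4 * w by rewrite /w /h; field.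
      by rewrite -mulf_div divff ?mul1r.
    have -> : 2 * y / (1 - z) = y / h by rewrite /h invfM invrK; ring.
    rewrite -(odd_natr l (ltnW l2)) -even_natr natrD -!even_natr.
    have -> : (2 * l + 2 * n - 1)%:R = 2 * l%:R + 2 * n%:R - 1 :> R.
      by rewrite !even_natr -natrD natrB//; lia.
    by ring.
  rewrite (integral_std_tetra _ (size_xpoly R i2 l2) (size_ypoly R _ _ j1 n1)) cxE//.
  have [<-|_] := eqVneq i l; last by rewrite !mulr0 !mul0r.
  rewrite cyE//; [|lia|lia].
  have [<-|_] := eqVneq j n; last by rewrite !mulr0 !mul0r.
  by rewrite cyE// ?mulr1 ?mulrA//; lia.
Qed.
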